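(* Let $\beta=\sigma_i^{r_1}\sigma_j^{r_2}\cdots\sigma_i^{r_{2l-1}}\sigma_j^{r_{2l}}\in B_3$ with $\{i,j\}=\{1,2\}$, $l\ge2$ and all $r_q\neq0$, and let $D(K)=\widehat\beta$ be the diagram of its braid closure $K$. Assume that every negative exponent satisfies $r_q\le-3$ and that every positive syllable is cyclically neighbored on both sides by negative syllables. Then $\beta$ is generic and the parameters $k$ and $s$ of its Schreier normal form are given by: (1) $k=-\#\{\text{induced products } \sigma_2^{n_2}\sigma_1^{n_1}\text{ of negative syllables of }\beta,\ \text{where } n_1,n_2\le-3\}$, where the induced products (a negative syllable in $\sigma_2$ immediately followed by a negative syllable in $\sigma_1$) are counted cyclically in the braid word $\beta$; (2) $s=t^-(D)=\#\{\text{negative syllables in }\beta\}$.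
   Context: $B_3=\langle\sigma_1,\sigma_2\mid\sigma_1\sigma_2\sigma_1=\sigma_2\sigma_1\sigma_2\rangle$. The factors $\sigma_i^{r_1},\sigma_j^{r_2},\dots$ are the syllables of $\beta$, positive or negative according to the sign of the exponent; ''cyclically'' means that the last syllable is followed by the first. A twist region of $D$ is a longest possible string of bigons in the projection graph (possibly a single crossing); it is negative if its crossings correspond to a negative syllable of $\beta$, and $t^-(D)$ is the number of negative twist regions. Schreier normal form: put $C=(\sigma_1\sigma_2)^3$, which is central in $B_3$. Every 3-braid is conjugate to a normal form $C^k\eta'$ with $k\in\mathbb{Z}$ and $\eta'$ one of: $\sigma_1^{-p_1}\sigma_2^{q_1}\cdots\sigma_1^{-p_s}\sigma_2^{q_s}$ with $s,p_i,q_i\ge1$; $\sigma_1^p$ with $p\in\mathbb{Z}$; $\sigma_1\sigma_2$; $\sigma_1\sigma_2\sigma_1$; $\sigma_1\sigma_2\sigma_1\sigma_2$. This normal form represents the conjugacy class uniquely (in the first case up to cyclic permutation of the pairs $(p_i,q_i)$), so $k$ and $s$ are determined by the conjugacy class. $\beta$ is generic if its normal form is of the first type, $C^k\sigma_1^{-p_1}\sigma_2^{q_1}\cdots\sigma_1^{-p_s}\sigma_2^{q_s}$. *)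

(* Defs.v *)
From mathcomp Require Import all_boot all_order all_algebra.
Set Implicit Arguments.
Unset Strict Implicit.
Unset Printing Implicit Defensive.

(* [false] is sigma_1 and [true] is sigma_2, so that a generator [g], read as
   a natural number, is the 0-based position of the left one of the two
   adjacent strands (out of the positions 0, 1, 2) that it crosses. *)
Definition gen := bool.

(* The letter [(g, e)] is the generator [g] if [e = false] and its inverse if
   [e = true]; an element of B_3 is represented by a word. *)
Definition letter := (gen * bool)%type.
Definition word := seq letter.

Definition sigma (g : gen) : word := [:: (g, false)].
Notation sigma1 := (sigma false).
Notation sigma2 := (sigma true).

Definition inv_word (w : word) : word := rev [seq (x.1, ~~ x.2) | x <- w].

Definition exp_word (w : word) (z : int) : word :=
  flatten (nseq `|z|%N (if (z < 0)%R then inv_word w else w)).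

(* Equality in B_3 = < sigma_1, sigma_2 |
     sigma_1 sigma_2 sigma_1 = sigma_2 sigma_1 sigma_2 >. *)
Inductive braid_eq : word -> word -> Prop :=
| braid_refl w : braid_eq w w
| braid_sym u v : braid_eq u v -> braid_eq v u
| braid_trans u v w : braid_eq u v -> braid_eq v w -> braid_eq u w
| braid_cat u u' v v' :
    braid_eq u u' -> braid_eq v v' -> braid_eq (u ++ v) (u' ++ v')
| braid_cancel g e : braid_eq [:: (g, e); (g, ~~ e)] [::]
| braid_rel : braid_eq (sigma1 ++ sigma2 ++ sigma1) (sigma2 ++ sigma1 ++ sigma2).

Definition braid_conj (u v : word) : Prop :=
  exists g : word, braid_eq (g ++ u ++ inv_word g) v.

Definition C : word := exp_word (sigma1 ++ sigma2) 3.

(* The factor eta' of a Schreier normal form C^k eta'. *)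
Inductive schreier_tail :=
| Alternating of seq (nat * nat)
| Power of int
| S12
| S121
| S1212.

Definition tail_word (t : schreier_tail) : word :=
  match t with
  | Alternating pqs =>
      flatten [seq exp_word sigma1 (- pq.1%:Z)%R ++ exp_word sigma2 pq.2%:Z
              | pq <- pqs]
  | Power p => exp_word sigma1 p
  | S12 => sigma1 ++ sigma2
  | S121 => sigma1 ++ sigma2 ++ sigma1
  | S1212 => sigma1 ++ sigma2 ++ sigma1 ++ sigma2
  end.

Definition tail_valid (t : schreier_tail) : bool :=
  match t with
  | Alternating pqs =>
      (0 < size pqs) && all (fun pq => (0 < pq.1) && (0 < pq.2)) pqs
  | _ => true
  end.

Definition schreier_normal_form (beta : word) (k : int) (t : schreier_tail) :=
  tail_valid t /\ braid_conj beta (exp_word C k ++ tail_word t).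

Definition generic (beta : word) : Prop :=
  exists k pqs, schreier_normal_form beta k (Alternating pqs).

(* The braid sigma_i^(r_0) sigma_j^(r_1) sigma_i^(r_2) ... sigma_j^(r_(2l-1)):
   syllables are numbered from 0. *)
Section Syllables.
Variables (i j : gen) (l : nat) (r : l.*2.-tuple int).

Definition syl_gen (q : 'I_(l.*2)) : gen := if odd q then j else i.

Definition syllable_word : word :=
  flatten [seq exp_word (sigma (syl_gen q)) (tnth r q) | q <- enum 'I_(l.*2)].

Definition negative_syllables : {set 'I_(l.*2)} := [set q | tnth r q < 0]%R.

(* Occurrences sigma_2^(n_2) sigma_1^(n_1) with n_1, n_2 <= -3; [ordS] is the
   cyclic successor. *)
Definition induced_products : {set 'I_(l.*2)} :=
  [set q | [&& syl_gen q == true, syl_gen (ordS q) == false,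
               (tnth r q <= -3)%R & (tnth r (ordS q) <= -3)%R]].

End Syllables.

(* The projection graph of the closure of the braid word [w], as a rotation
   system.  The vertices are the crossings, one for each letter of [w].  The
   dart [(c, up, east)] is the half-edge at crossing [c] going up (towards
   the next letters) or down, on the right ([east]) or on the left. *)
Section ClosureDiagram.
Variable w : word.

Definition crossing := 'I_(size w).
Definition dart := (crossing * bool * bool)%type.

Definition crossing_letter (c : crossing) : letter := tnth (in_tuple w) c.
Definition left_pos (c : crossing) : nat := (crossing_letter c).1.

Definition touches (p : nat) (c : crossing) : bool :=
  (p == left_pos c) || (p == (left_pos c).+1).

(* The first crossing met on the strand position [p] when moving cyclically
   by steps [f], starting after [c]; it is [c] itself if there is no other. *)
Definition next_crossing (f : crossing -> crossing) (p : nat) (c : crossing) :=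
  let s := traject f (f c) (size w) in nth c s (find (touches p) s).

Definition other_end (d : dart) : dart :=
  let: (c, up, east) := d in
  let p := left_pos c + east in
  let c' := next_crossing (if up then @ordS _ else @ord_pred _) p c in
  (c', ~~ up, p != left_pos c').

(* Counterclockwise: NE -> NW -> SW -> SE -> NE. *)
Definition rotate (d : dart) : dart :=
  let: (c, up, east) := d in (c, east, ~~ up).

(* The faces of the diagram are the orbits of [face]. *)
Definition face (d : dart) : dart := rotate (other_end d).

(* [c] and [c'] are the two vertices of a bigon. *)
Definition bigon_between (c c' : crossing) : bool :=
  [exists d : dart, [&& order face d == 2, d.1.1 == c & (face d).1.1 == c']].

(* Two crossings lie in the same maximal string of bigons when a string of
   bigons, possibly empty, leads from one to the other. *)
Definition twist_regions : {set {set crossing}} :=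
  [set [set c' | connect bigon_between c c'] | c : crossing].

Definition negative_twist_regions : {set {set crossing}} :=
  [set T in twist_regions | [forall c in T, (crossing_letter c).2]].

Definition t_minus : nat := #|negative_twist_regions|.

End ClosureDiagram.

(* Main.v *)
(* Write x = sigma_1 sigma_2 sigma_1, y = sigma_1 sigma_2, so that x^2 = y^3 = C,
   sigma_1^-1 = x^-1 y and sigma_2 = x^-1 y^2.  Modulo C the group is the free
   product Z/2 * Z/3, which acts on its space of ends: the infinite words in x
   and y^(+-1).  This action is lifted to an action of B_3 carrying two integer
   counters, which every generator shifts equivariantly.  An alternating word
   of s pairs times C^k fixes its attracting end and shifts the counters there
   by (s, k); at its repelling end the first shift is at most 0.  Since a
   conjugating braid carries fixed ends to fixed ends with the same shift, k and
   s are conjugacy invariants.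

   The normal form itself is obtained by replacing, at every junction of two
   negative syllables, sigma_g^-1 sigma_g'^-1 by sigma_g' Delta^-1, and moving
   all Delta^-1 to the end; exponents at most -3 stay negative.  Going once
   around the braid, junctions sigma_2 sigma_1 and sigma_1 sigma_2 alternate, so
   the number of Delta^-1 is twice the number of induced products. *)

From Stdlib Require Import FunctionalExtensionality Setoid Morphisms.
Require Import Defs.
From mathcomp Require Import all_boot all_order all_algebra.
From mathcomp Require Import zify.
Set Implicit Arguments.
Unset Strict Implicit.
Unset Printing Implicit Defensive.
Import Order.TTheory GRing.Theory Num.Theory.

(** * Cyclic iteration and bigons *)

Section CyclicIteration.
Variables (n : nat) (f : 'I_n -> 'I_n).
Hypothesis f_cyclic : forall c t, (0 < t < n)%N -> iter t f c != c.
Hypothesis f_trans : forall c c', exists2 t, (t < n)%N & c' = iter t.+1 f c.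

(** This is [next_crossing] with its step and its touching test made abstract, so that upward and
    downward travel are one case. *)
Definition next_hit (a : pred 'I_n) c :=
  let s := traject f (f c) n in nth c s (find a s).

Lemma next_in_cycle (a : pred 'I_n) c c1 :
  a c1 -> a (next_hit a c) /\
  exists k, [/\ (k < n)%N, next_hit a c = iter k.+1 f c &
    forall t, (t < n)%N -> a (iter t.+1 f c) -> (k <= t)%N].
Proof.
move=> ac1; rewrite /next_hit /=; set s := traject f (f c) n.
have nth_s t : (t < n)%N -> nth c s t = iter t.+1 f c.
  by move=> tn; rewrite (set_nth_default (f c)) ?size_traject // nth_traject // -iterSr.
have has_s : has a s.
  have [t tn c1E] := f_trans c c1; apply/hasP; exists c1 => //.
  by rewrite c1E -nth_s // mem_nth // size_traject.
have kn : (find a s < n)%N by move: has_s; rewrite has_find size_traject.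
split; first exact: nth_find.
exists (find a s); split=> //; first exact: nth_s.
move=> t tn at_; rewrite leqNgt; apply/negP => /(before_find c).
by rewrite nth_s // at_.
Qed.

(** A third point [c1] would lie beyond [c'] but before the return to [c]; the next hit after [c']
    would come at [c1] or earlier, too soon to be [c] or [c']. *)
Lemma next_in_cycle2 (a : pred 'I_n) c c' c1 :
  c' = next_hit a c -> c = next_hit a c' \/ c' = next_hit a c' ->
  c != c' -> a c -> a c1 ->
  c1 = c \/ c1 = c'.
Proof.
move=> c'E c2E cc' ac ac1.
have [ac' [k [kn ck k_min]]] := next_in_cycle c ac1.
have [ac'' [k' [k'n ck' k'_min]]] := next_in_cycle c' ac1.
rewrite -c'E in ac' ck.
have [t tn c1E] := f_trans c c1.
have [/eqP-> //|c1c] := boolP (c1 == c); first by left.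
have [/eqP-> //|c1c'] := boolP (c1 == c'); first by right.
have kt : (k <= t)%N by apply: (k_min t tn); rewrite -c1E.
have kt' : (k < t)%N.
  by rewrite ltn_neqAle kt andbT; apply: contra c1c' => /eqP ktE; rewrite c1E ck ktE.
have c1E' : c1 = iter (t - k.+1).+1 f c'.
  by rewrite ck -iterD c1E; congr (iter _ f c); lia.
have k't : (k' <= t - k.+1)%N by apply: k'_min; [lia | rewrite -c1E'].
(* The first return of [f] to [c] takes [n] steps, so [t.+1 = n] would make [c1] equal to [c]. *)
have tn' : (t.+1 < n)%N.
  rewrite ltn_neqAle tn andbT; apply: contra c1c => /eqP tE.
  have [u un cu] := f_trans c c; rewrite cu c1E.
  suff -> : u = t by [].
  apply/eqP; rewrite eqn_leq; apply/andP; split; first by lia.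
  rewrite -ltnS tE leqNgt; apply/negP => un'.
  by have := f_cyclic c (t := u.+1); rewrite /= -iterS -cu eqxx un' => /(_ isT).
case: c2E => c2E; rewrite -c2E in ck' ac''.
  have := f_cyclic c (t := (k'.+1 + k.+1)%N); rewrite iterD -ck -ck' eqxx.
  by case/(_ _)/negP => //; lia.
have := f_cyclic c' (t := k'.+1); rewrite -ck' eqxx.
by case/(_ _)/negP => //; lia.
Qed.

End CyclicIteration.

(** * Cyclic successor and predecessor of ordinals *)

Lemma iter_ordS n (c : 'I_n) t : iter t (@ordS n) c = (c + t) %% n :> nat.
Proof.
elim: t => [|t IHt]; first by rewrite addn0 modn_small.
by rewrite iterS /= IHt -addn1 modnDml -addnA addn1.
Qed.

Lemma ordS_cyclic n (c : 'I_n) t : (0 < t < n)%N -> iter t (@ordS n) c != c.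
Proof.
move=> /andP [t_gt0 tn]; apply/eqP => /(congr1 val) /=.
rewrite iter_ordS => ct; have cn := ltn_ord c.
have [h|h] := ltnP (c + t) n; first by rewrite modn_small // in ct; lia.
have := ct; rewrite -{1}(subnK h) modnDr modn_small; lia.
Qed.

Lemma ordS_trans n (c c' : 'I_n) : exists2 t, (t < n)%N & c' = iter t.+1 (@ordS n) c.
Proof.
have [cn c'n] := (ltn_ord c, ltn_ord c').
have [h|h] := ltnP c c'.
  exists (c' - c.+1)%N; first by lia.
  by apply: ord_inj; rewrite iter_ordS modn_small; lia.
exists (c' + n - c.+1)%N; first by lia.
apply: ord_inj; rewrite iter_ordS.
have -> : (c + (c' + n - c.+1).+1 = c' + n)%N by lia.
by rewrite modnDr modn_small.
Qed.

Lemma iter_ord_predK n t : cancel (iter t (@ord_pred n)) (iter t (@ordS n)).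
Proof. by elim: t => // t IHt c; rewrite iterSr iterS ord_predK IHt. Qed.

Lemma iter_ordSK n t : cancel (iter t (@ordS n)) (iter t (@ord_pred n)).
Proof. by elim: t => // t IHt c; rewrite iterSr iterS ordSK IHt. Qed.

Lemma ord_pred_cyclic n (c : 'I_n) t :
  (0 < t < n)%N -> iter t (@ord_pred n) c != c.
Proof.
move=> tn; apply/eqP => ct; have := ordS_cyclic c tn.
by rewrite -{1}ct iter_ord_predK eqxx.
Qed.

Lemma ord_pred_trans n (c c' : 'I_n) :
  exists2 t, (t < n)%N & c' = iter t.+1 (@ord_pred n) c.
Proof.
have [t tn cE] := ordS_trans c' c; exists t => //.
by rewrite cE iter_ordSK.
Qed.

(** * Faces and bigons of the closed braid *)

Section Bigons.
Variable w : word.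
Hypothesis w_gt1 : (1 < size w)%N.

Let gen_at (c : crossing w) : gen := (crossing_letter c).1.

Lemma touches_middle (c : crossing w) : touches 1 c.
Proof. by rewrite /touches /left_pos; case: (_.1). Qed.

(** The sum [g + g] is 0 or 2, the outer position that only crossings of [g] reach. *)
Lemma touches_outer (g : gen) (c : crossing w) : touches (g + g) c = (gen_at c == g).
Proof. by rewrite /touches /left_pos /gen_at; case: (_.1); case: g. Qed.

Lemma next_crossing_adjacent (f : crossing w -> crossing w) p c :
  touches p (f c) -> next_crossing f p c = f c.
Proof.
rewrite /next_crossing; case: (size w) w_gt1 => // n _.
by rewrite trajectS /= => ->.
Qed.

Definition step (up : bool) : crossing w -> crossing w :=
  if up then @ordS _ else @ord_pred _.

Lemma stepK up : cancel (step up) (step (~~ up)).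
Proof. by case: up; [exact: ordSK | exact: ord_predK]. Qed.

Lemma step_cyclic up c t : (0 < t < size w)%N -> iter t (step up) c != c.
Proof. by case: up; [exact: ordS_cyclic | exact: ord_pred_cyclic]. Qed.

Lemma step_trans up c c' : exists2 t, (t < size w)%N & c' = iter t.+1 (step up) c.
Proof. by case: up; [exact: ordS_trans | exact: ord_pred_trans]. Qed.

Lemma step_neq up c : step up c != c.
Proof. exact: (step_cyclic up c (t := 1)). Qed.

(** Every crossing touches position 1, so a dart on the middle position ends at the neighbouring
    letter. The darts with [east = gen_at c] are the outer ones. *)
Lemma face_middle c up :
  face (c, up, ~~ gen_at c) = (step up c, ~~ gen_at (step up c), up).
Proof.
rewrite /face /= negbK -/(step up).
have -> : (left_pos c + ~~ gen_at c = 1)%N by rewrite /left_pos /gen_at; case: (_.1).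
rewrite next_crossing_adjacent ?touches_middle //.
by congr (_, _, _); rewrite /left_pos /gen_at; case: (_.1).
Qed.

Lemma gen_next_hit up c :
  gen_at (next_hit (step up) (touches (gen_at c + gen_at c)) c) = gen_at c.
Proof.
apply/eqP; rewrite -touches_outer.
have ac : touches (gen_at c + gen_at c) c by rewrite touches_outer.
by have [] := next_in_cycle (step_trans up) c ac.
Qed.

Lemma face_outer c up :
  face (c, up, gen_at c) =
  (next_hit (step up) (touches (gen_at c + gen_at c)) c, gen_at c, up).
Proof.
rewrite /face /= negbK -/(step up).
rewrite -[left_pos c]/(nat_of_bool (gen_at c)).
rewrite -[next_crossing _ _ _]/(next_hit (step up) (touches (gen_at c + gen_at c)) c).
have := gen_next_hit up c; rewrite {1}/left_pos {1}/gen_at => ->.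
by congr (_, _, _); case: (gen_at c).
Qed.

Lemma face_outer_adjacent c up :
  gen_at (step up c) = gen_at c ->
  face (c, up, gen_at c) = (step up c, gen_at c, up).
Proof.
move=> gS; rewrite face_outer.
by rewrite [next_hit _ _ _](@next_crossing_adjacent (step up)) // touches_outer gS.
Qed.

(** For an arbitrary map an orbit of size 2 can close up at [x] or get stuck at [f x]. *)
Lemma order2 (T : finType) (f : T -> T) x :
  order f x = 2 -> f x != x /\ (f (f x) = x \/ f (f x) = f x).
Proof.
move=> o2; have := orbit_uniq f x; rewrite /orbit o2 /= inE andbT eq_sym => fx.
split=> //; have := looping_order f x; rewrite /looping o2 /= !inE.
by case/orP => /eqP; [left | right].
Qed.

Lemma bigon_between_step c c' :
  c' = ordS c -> gen_at c = gen_at c' ->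
  bigon_between c c' /\ bigon_between c' c.
Proof.
move=> c'E gg'.
have cE : c = step false c' by rewrite c'E /= ordSK.
(* The bigon is traced by the upper left dart of [c] and the lower right dart of [c']; the generator
   decides which of them is outer. *)
have f1 : face (c, true, false) = (c', false, true).
  have [g1|g0] := boolP (gen_at c).
    by have := face_middle c true; rewrite /= -c'E -gg' g1.
  by have := @face_outer_adjacent c true; rewrite /= -c'E -gg' (negbTE g0) => ->.
have f2 : face (c', false, true) = (c, true, false).
  have [g1|g0] := boolP (gen_at c').
    by have := @face_outer_adjacent c' false; rewrite -cE gg' g1 => ->.
  by have := face_middle c' false; rewrite -cE gg' (negbTE g0).
have o2 d d' : face d = d' -> face d' = d -> d != d' -> order (@face w) d == 2.
  move=> dd' d'd dnd; apply/eqP.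
  apply: (@order_cycle _ _ [:: d; d']); rewrite /= ?inE ?eqxx //.
    by rewrite dd' d'd !eqxx.
  by rewrite andbT.
split; apply/existsP.
  exists (c, true, false); rewrite (o2 _ _ f1 f2) ?f1 /= ?eqxx //.
  by rewrite !xpair_eqE andbF.
exists (c', false, true); rewrite (o2 _ _ f2 f1) ?f2 /= ?eqxx //.
by rewrite !xpair_eqE andbF.
Qed.

(* The last case is that of an unbounded face of the closed braid, left of all
   strands or right of them, with only the two corners [c] and [c']. *)
Lemma bigon_between_inv c c' :
  bigon_between c c' ->
  gen_at c = gen_at c' /\
  (c' = ordS c \/ c = ordS c' \/
   forall c1, gen_at c1 = gen_at c -> c1 = c \/ c1 = c').
Proof.
case/existsP => -[[c0 up] east] /and3P [/eqP /order2 [neq ff] /eqP c0E].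
rewrite [c0]c0E {c0 c0E} in neq ff *.
have adjacent u : c' = step u c -> c' = ordS c \/ c = ordS c'.
  by case: u => ->; [left | right; rewrite /= ord_predK].
have [eastE|eastN] := eqVneq east (gen_at c); last first.
  have eastE : east = ~~ gen_at c by case: east (gen_at c) eastN {neq ff} => [] [].
  rewrite {east eastN}eastE face_middle in neq ff * => /eqP /= c'E.
  (* With different generators the face cannot close after two steps: the direction bits disagree,
     or [step] would fix [c']. *)
  have [gg|gN] := eqVneq (gen_at c) (gen_at c').
    by split=> //; case: (adjacent up (esym c'E)); [left | right; left].
  rewrite c'E in ff.
  have [upE|upN] := eqVneq up (gen_at c').
    rewrite [X in face (_, _, X)]upE face_outer in ff.
    case: ff => -[_ e1 e2]; move: gN e1 e2; rewrite upE.
      by case: (gen_at c) (gen_at c') => [] [].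
    by case: (gen_at c) (gen_at c') => [] [].
  have upE : up = ~~ gen_at c' by case: up (gen_at c') upN {neq ff c'E} => [] [].
  rewrite [X in face (_, _, X)]upE face_middle in ff.
  case: ff => -[e0 e1 e2].
    by move: gN e2; case: (gen_at c) (gen_at c') => [] [].
  by have := step_neq (~~ gen_at c') c'; rewrite e0 eqxx.
rewrite {east}eastE face_outer in neq ff * => /eqP /= c'E.
have gg := gen_next_hit up c; rewrite c'E in gg.
split=> //; rewrite c'E in neq ff.
have [upE|upN] := eqVneq up (gen_at c').
  (* Both darts are outer, so the face runs along an outer strand position and meets all crossings
     of that generator. *)
  right; right => c1 g1.
  have cc' : c != c'.
    by apply: contraNneq neq => ->; rewrite upE gg.
  rewrite upE -gg face_outer in ff c'E.
  apply: (next_in_cycle2 (step_cyclic (gen_at c')) (step_trans (gen_at c'))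
            (esym c'E) _ cc').
  - by case: ff => -[->]; [left | right].
  - by rewrite touches_outer gg.
  - by rewrite touches_outer gg g1.
have upE : up = ~~ gen_at c' by case: up (gen_at c') upN {neq ff c'E} => [] [].
rewrite upE -gg face_middle in ff.
case: ff => -[e0 _]; last by case: (gen_at c').
have c'S : c' = step (~~ gen_at c') c by rewrite -e0 stepK.
by case: (adjacent _ c'S) => ?; [left | right; left].
Qed.

End Bigons.

Local Open Scope ring_scope.

(** * Conjugacy invariance of k and s *)

Definition scons (e : bool) (s : nat -> bool) : nat -> bool :=
  fun n => if n is m.+1 then s m else e.
Definition stail (s : nat -> bool) : nat -> bool := fun n => s n.+1.

Lemma scons_head_tail s : scons (s 0%N) (stail s) = s.
Proof. by apply: functional_extensionality; case. Qed.

Lemma stail_scons e s : stail (scons e s) = s.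
Proof. exact: functional_extensionality. Qed.

(* [(b, s, m, k)] stands for the end x^b y^(s 0) x y^(s 1) x ..., where the bit
   [false] means y and [true] means y^-1, with two counters: [m] changes by the
   number of descents (a [false] followed by a [true]) created in [s], and [k]
   records the power of C. *)
Definition state := (bool * (nat -> bool) * int * int)%type.

(** The counter [k] is the exponent of C when the end is spelled with x^-1, y and y^2 in place of x,
    y and y^-1; thus x = C x^-1 and y^-1 = C^-1 y^2 account for its changes. *)
Definition act_x (z : state) : state :=
  let: (b, s, m, k) := z in (~~ b, s, m, k + (~~ b)%:Z).
Definition act_xV (z : state) : state :=
  let: (b, s, m, k) := z in (~~ b, s, m, k - b%:Z).

Definition act_y (z : state) : state :=
  let: (b, s, m, k) := z in
  if b then (false, scons false s, m + (s 0%N)%:Z, k)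
  else if s 0%N then (true, stail s, m, k + 1)
  else (false, scons true (stail s), m - (s 1%N)%:Z, k).
Definition act_yV (z : state) : state :=
  let: (b, s, m, k) := z in
  if b then (false, scons true s, m, k - 1)
  else if s 0%N then (false, scons false (stail s), m + (s 1%N)%:Z, k)
  else (true, stail s, m - (s 1%N)%:Z, k).

Lemma act_xK : cancel act_x act_xV.
Proof. by case=> [[[[] s] m] k] /=; rewrite ?addr0 ?subr0 ?addrK. Qed.
Lemma act_xVK : cancel act_xV act_x.
Proof. by case=> [[[[] s] m] k] /=; rewrite ?addr0 ?subr0 ?subrK. Qed.

Lemma scons_stail e s : s 0%N = e -> scons e (stail s) = s.
Proof. by move<-; exact: scons_head_tail. Qed.

Lemma act_yK : cancel act_y act_yV.
Proof.
case=> [[[[] s] m] k] /=; first by rewrite stail_scons addrK.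
by case: ifP => s0 /=; rewrite ?stail_scons ?scons_stail // /stail ?addrK ?subrK.
Qed.
Lemma act_yVK : cancel act_yV act_y.
Proof.
case=> [[[[] s] m] k] /=; first by rewrite stail_scons subrK.
by case: ifP => s0 /=; rewrite ?stail_scons ?scons_stail // /stail ?addrK ?subrK.
Qed.

Lemma act_x2_y3 z : act_x (act_x z) = act_y (act_y (act_y z)).
Proof.
case: z => [[[[] s] m] k] /=.
  by rewrite !stail_scons addr0 addrK.
by case: ifP => s0 /=; rewrite ?stail_scons ?scons_stail // /stail ?addr0 ?addrK ?subrK.
Qed.

(** From x = y sigma_1 and y = sigma_1 sigma_2 one gets sigma_1 = y^-1 x and sigma_2 = x^-1 y^2. *)
Definition act_letter (x : letter) : state -> state :=
  match x with
  | (false, false) => act_yV \o act_x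
  | (false, true) => act_xV \o act_y
  | (true, false) => act_xV \o act_y \o act_y
  | (true, true) => act_yV \o act_yV \o act_x
  end.

Definition act (w : word) (z : state) : state := foldr act_letter z w.

Lemma act_cat u v z : act (u ++ v) z = act u (act v z).
Proof. exact: foldr_cat. Qed.

Lemma act_braid_eq u v : braid_eq u v -> act u =1 act v.
Proof.
elim=> {u v} [w|u v _ IH|u v w _ IH1 _ IH2|u u' v v' _ IH1 _ IH2|g e|] z //.
- by rewrite IH1 IH2.
- by rewrite !act_cat IH1 IH2.
- by case: g e => [] [] /=; rewrite !(act_xK, act_xVK, act_yK, act_yVK).
(* Both sides of the braid relation act as x, the right one through x^-1 y^3 = x^-1 x^2. *)
by rewrite /= !(act_xVK, act_yK, act_yVK) -act_x2_y3 act_xK.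
Qed.

Definition shift (a c : int) (z : state) : state :=
  let: (b, s, m, k) := z in (b, s, m + a, k + c).

(** The increments of the counters depend only on [b] and [s]. *)
Lemma act_shift w a c z : act w (shift a c z) = shift a c (act w z).
Proof.
elim: w => //= [[g e] w ->].
have hx t : act_x (shift a c t) = shift a c (act_x t).
  by case: t => [[[b s] m] k] /=; rewrite addrAC.
have hxV t : act_xV (shift a c t) = shift a c (act_xV t).
  by case: t => [[[b s] m] k] /=; rewrite addrAC.
have hy t : act_y (shift a c t) = shift a c (act_y t).
  by case: t => [[[[] s] m] k] /=; first (by rewrite addrAC); case: ifP => _ //=;
     rewrite addrAC.
have hyV t : act_yV (shift a c t) = shift a c (act_yV t).
  by case: t => [[[[] s] m] k] /=; first (by rewrite addrAC); case: ifP => _ //=;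
     rewrite addrAC.
by case: g e => [] [] /=; rewrite !(hx, hxV, hy, hyV).
Qed.

Lemma shiftD a c a' c' z : shift a c (shift a' c' z) = shift (a' + a) (c' + c) z.
Proof. by case: z => [[[b s] m] k] /=; rewrite !addrA. Qed.

Lemma shift00 z : shift 0 0 z = z.
Proof. by case: z => [[[b s] m] k] /=; rewrite !addr0. Qed.

Lemma act_letterK g e : cancel (act_letter (g, e)) (act_letter (g, ~~ e)).
Proof.
move=> z; have /(_ z) := act_braid_eq (braid_cancel g (~~ e)).
by rewrite negbK.
Qed.

Lemma act_invK w : cancel (act w) (act (inv_word w)).
Proof.
elim: w => // -[g e] w IHw z.
rewrite /inv_word map_cons rev_cons -cats1 act_cat.
exact: etrans (congr1 _ (act_letterK g e _)) (IHw z).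
Qed.

Lemma act_C z : act C z = shift 0 1 z.
Proof.
case: z => [[[b s] m] k].
have -> : act C (b, s, m, k) = act_y (act_y (act_y (b, s, m, k))).
  rewrite /C /exp_word /= !(act_xVK, act_yK, act_yVK).
  by [].
by rewrite -act_x2_y3 /= negbK addr0; case: b; rewrite ?addr0 // addr0.
Qed.

Lemma act_exp_word_nat w n z :
  act (flatten (nseq n w)) z = iter n (act w) z.
Proof. by elim: n => //= n IHn; rewrite act_cat IHn. Qed.

Lemma act_exp_C k z : act (exp_word C k) z = shift 0 k z.
Proof.
have hC t : act (inv_word C) t = shift 0 (- 1) t.
  have Ct : act C (shift 0 (- 1) t) = t by rewrite act_C shiftD addr0 addNr shift00.
  by rewrite -{1}Ct act_invK.
have iter_shift n a t : iter n (shift 0 a) t = shift 0 (a *+ n) t.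
  elim: n => [|n IHn] /=; first by rewrite shift00.
  by rewrite IHn shiftD addr0 -mulrSr.
rewrite /exp_word act_exp_word_nat; case: ifP => hk.
  by rewrite (eq_iter hC) iter_shift mulNrn natz ltz0_abs ?opprK.
by rewrite (eq_iter act_C) iter_shift natz gez0_abs // leNgt hk.
Qed.

(* The bit [false] stands for sigma_1^-1 = x^-1 y and [true] for
   sigma_2 = x^-1 y^2: both prepend their bit to an end with [b = true]. *)
Definition positive_word (v : seq bool) : word := [seq (e, ~~ e) | e <- v].

Fixpoint prepend (v : seq bool) (s : nat -> bool) : nat -> bool :=
  if v is e :: v' then scons e (prepend v' s) else s.

(** The bit [d] is the one following [v], with which a final [false] may form a descent. *)
Fixpoint descents (v : seq bool) (d : bool) : nat :=
  if v is e :: v' then (~~ e && head d v') + descents v' d else 0.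

Lemma prepend_head v s : prepend v s 0%N = head (s 0%N) v.
Proof. by case: v. Qed.

Lemma act_positive_true v s m k :
  act (positive_word v) (true, s, m, k) =
  (true, prepend v s, m + (descents v (s 0%N))%:Z, k).
Proof.
elim: v => [|e v IHv] /=; first by rewrite addr0.
rewrite IHv /= -prepend_head.
by case: e => /=; rewrite ?stail_scons; congr (_, _, _, _); lia.
Qed.

(* An end with [b = false] either escapes to [b = true] or loses letters. *)
Lemma act_positive_false v s m k :
  let: (b, _, m', _) := act (positive_word v) (false, s, m, k) in
  b \/ m' <= m.
Proof.
elim: v => [|e v] /=; first by right.
case: (act _ _) => [[[[] s'] m'] k'] /=; first by case: e; left.
case=> // hm; case: e => /=; case: (s' 0%N) => /=; try by left.
- by right; rewrite /stail; lia.
- by right.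
Qed.

Definition alternating_letters (pqs : seq (nat * nat)) : seq bool :=
  flatten [seq nseq pq.1 false ++ nseq pq.2 true | pq <- pqs].

Lemma flatten_nseq1 (T : Type) n (a : T) : flatten (nseq n [:: a]) = nseq n a.
Proof. by elim: n => //= n ->. Qed.

Lemma exp_sigma g (z : int) : exp_word (sigma g) z = nseq `|z| (g, z < 0).
Proof. by rewrite /exp_word; case: ifP; rewrite /= flatten_nseq1. Qed.

Lemma tail_word_alternating pqs :
  tail_word (Alternating pqs) = positive_word (alternating_letters pqs).
Proof.
rewrite /positive_word /alternating_letters map_flatten -map_comp /=.
congr flatten; apply: eq_map => -[p q] /=.
rewrite map_cat !map_nseq !exp_sigma /= abszN.
by congr (_ ++ _); case: p => // p; rewrite oppr_lt0.
Qed.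

Lemma descents_cat u v d :
  descents (u ++ v) d = (descents u (head d v) + descents v d)%N.
Proof. by elim: u => //= e [|e' u] ->; rewrite ?addnA. Qed.

(** Each pair has one descent, between its [false] and its [true] bits, and none at its end. *)
Lemma descents_alternating pqs :
  all (fun pq => (0 < pq.1) && (0 < pq.2))%N pqs ->
  descents (alternating_letters pqs) false = size pqs.
Proof.
elim: pqs => //= -[p q] pqs IH /andP [/andP [/= p_gt0 q_gt0] /[dup] hp /IH hpqs].
rewrite /alternating_letters /= descents_cat.
rewrite -/(alternating_letters pqs) hpqs.
have -> : head false (alternating_letters pqs) = false.
  by case: pqs hp {IH hpqs} => [|[[|p'] q'] pqs].
rewrite descents_cat.
have hF n d : (descents (nseq n.+1 false) d = d)%N.
  by elim: n => [|n] /=; rewrite ?addn0 // => ->.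
have hT n : (descents (nseq n true) false = 0)%N by elim: n.
by case: p p_gt0 => // p _; case: q q_gt0 => // q _; rewrite hF hT.
Qed.

Lemma prependE v s n :
  prepend v s n = if (n < size v)%N then nth false v n else s (n - size v)%N.
Proof. by elim: v n => [|e v IHv] [|n] //=; rewrite IHv. Qed.

(** This stream gives the attracting end of [positive_word v]. *)
Definition periodic (v : seq bool) : nat -> bool :=
  fun n => nth false v (n %% size v).

Lemma prepend_periodic v : v != [::] -> prepend v (periodic v) = periodic v.
Proof.
move=> v_neq0; apply: functional_extensionality => n.
rewrite prependE /periodic; case: ltnP => hn; first by rewrite modn_small.
by rewrite -{2}(subnK hn) modnDr.
Qed.

(* The end [z] is fixed by [w], up to the counters. *)
Definition has_drift (w : word) (a c : int) : Prop :=
  exists z, act w z = shift a c z.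

Lemma has_drift_conj u v a c : braid_conj u v -> has_drift u a c <-> has_drift v a c.
Proof.
move=> [g /act_braid_eq guv]; split=> -[z hz].
  by exists (act g z); rewrite -guv !act_cat act_invK hz act_shift.
exists (act (inv_word g) z); rewrite -act_shift -hz -guv !act_cat.
by rewrite act_invK.
Qed.

Lemma alternating_drift k pqs :
  tail_valid (Alternating pqs) ->
  has_drift (exp_word C k ++ tail_word (Alternating pqs)) (size pqs)%:Z k.
Proof.
move=> /andP [pqs_gt0 pqs_pos]; rewrite tail_word_alternating.
set v := alternating_letters pqs; exists (true, periodic v, 0, 0).
have [v_neq0 v0] : v != [::] /\ head false v = false.
  by rewrite /v; case: pqs pqs_gt0 pqs_pos {v} => [|[[|p] q] pqs].
rewrite act_cat act_positive_true act_exp_C prepend_periodic //= addr0.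
by rewrite /periodic mod0n nth0 v0 descents_alternating.
Qed.

(** A fixed end with [b = false] never has a positive first shift. With [b = true] the stream
    satisfies [s = prepend v s], so it starts with the [false] of [v] and the first shift is the
    number of descents. *)
Lemma alternating_drift_inj k pqs a c :
  tail_valid (Alternating pqs) -> 0 < a ->
  has_drift (exp_word C k ++ tail_word (Alternating pqs)) a c ->
  (size pqs)%:Z = a /\ k = c.
Proof.
move=> /andP [pqs_gt0 pqs_pos] a_gt0 [[[[b s] m] n]].
rewrite tail_word_alternating act_cat act_exp_C.
set v := alternating_letters pqs.
have [v_neq0 v0] : v != [::] /\ forall d, head d v = false.
  by rewrite /v; case: pqs pqs_gt0 pqs_pos {v} => [|[[|p] q] pqs].
case: b; last first.
  have := act_positive_false v s m n.
  case: (act _ _) => [[[b' s'] m'] n'] /= hb [b'F _ m'a _].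
  by case: hb => [|]; [rewrite b'F | lia].
rewrite act_positive_true => -[sE ha hk].
move: ha; rewrite -{1}sE prepend_head v0 descents_alternating //.
by split; lia.
Qed.

Lemma alternating_normal_form_inj beta k pqs k' pqs' :
  schreier_normal_form beta k (Alternating pqs) ->
  schreier_normal_form beta k' (Alternating pqs') ->
  k = k' /\ size pqs = size pqs'.
Proof.
move=> [v1 c1] [v2 c2].
have /(has_drift_conj _ _ c1)/(has_drift_conj _ _ c2) := alternating_drift k v1.
case/(alternating_drift_inj v2) => [|[->] ->] //.
by case/andP: v1; rewrite ltz_nat.
Qed.

(** * Reduction to normal form *)

Local Instance braid_eq_equivalence : Equivalence braid_eq.
Proof.
split; [exact: braid_refl|exact: braid_sym|].
by move=> u v w; exact: braid_trans.
Qed.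

Local Instance cat_braid_eq :
  Proper (braid_eq ==> braid_eq ==> braid_eq) (@cat letter).
Proof. by move=> u u' uu' v v' vv'; exact: braid_cat. Qed.

Lemma inv_wordK : involutive inv_word.
Proof.
move=> w; rewrite /inv_word map_rev revK -map_comp -[RHS]map_id.
by apply: eq_map => -[g e] /=; rewrite negbK.
Qed.

Lemma inv_word_cat u v : inv_word (u ++ v) = inv_word v ++ inv_word u.
Proof. by rewrite /inv_word map_cat rev_cat. Qed.

Lemma mul_inv_word w : braid_eq (w ++ inv_word w) [::].
Proof.
elim: w => [|[g e] w IHw]; first reflexivity.
rewrite -cat1s inv_word_cat -catA (catA w) IHw.
exact: braid_cancel.
Qed.

Lemma inv_word_mul w : braid_eq (inv_word w ++ w) [::].
Proof. by rewrite -{2}[w]inv_wordK; exact: mul_inv_word. Qed.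

Lemma braid_conj_catC u v : braid_conj (u ++ v) (v ++ u).
Proof. by exists v; rewrite -!catA mul_inv_word cats0; reflexivity. Qed.

Lemma braid_conj_trans u v w : braid_conj u v -> braid_conj v w -> braid_conj u w.
Proof.
move=> [g guv] [h hvw]; exists (h ++ g).
by rewrite inv_word_cat -hvw -guv -!catA; reflexivity.
Qed.

Lemma braid_eq_conj u v : braid_eq u v -> braid_conj u v.
Proof. by exists [::]; rewrite /= cats0. Qed.

(** * The half twist and conjugation by it *)

Definition Delta : word := sigma1 ++ sigma2 ++ sigma1.

(** The exchange of generators is made optional by [g], so that a word can be written relative to
    its first generator. *)
Definition flip (g : gen) (w : word) : word := [seq (g (+) x.1, x.2) | x <- w].

Lemma flip_flip g h w : flip g (flip h w) = flip (g (+) h) w.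
Proof. by rewrite /flip -map_comp; apply: eq_map => x /=; rewrite addbA. Qed.

Lemma flip_false w : flip false w = w.
Proof. by rewrite /flip -[RHS]map_id; apply: eq_map => -[]. Qed.

Lemma conj_inv a u v :
  braid_eq (a ++ u) (v ++ a) -> braid_eq (a ++ inv_word u) (inv_word v ++ a).
Proof.
move=> auv.
rewrite -[X in braid_eq X _]/([::] ++ _) -(inv_word_mul v) -catA.
by rewrite (catA v) -auv -!catA mul_inv_word cats0; reflexivity.
Qed.

Lemma inv_conj a u v :
  braid_eq (a ++ u) (v ++ a) -> braid_eq (inv_word a ++ v) (u ++ inv_word a).
Proof.
move=> auv.
rewrite -[v in X in braid_eq X _]cats0 -(mul_inv_word a) (catA v) -auv.
by rewrite !catA inv_word_mul; reflexivity.
Qed.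

(** The braid relation gives this for a positive letter, [conj_inv] for an inverse, and induction
    for a word. *)
Lemma Delta_flip w : braid_eq (Delta ++ w) (flip true w ++ Delta).
Proof.
have hpos g : braid_eq (Delta ++ sigma g) (sigma (~~ g) ++ Delta).
  case: g.
    exact: (braid_cat (braid_refl sigma1) (braid_sym braid_rel)).
  exact: (braid_cat braid_rel (braid_refl sigma1)).
have hletter x : braid_eq (Delta ++ [:: x]) ([:: (~~ x.1, x.2)] ++ Delta).
  by case: x => g []; [exact: (conj_inv (hpos g)) | exact: hpos].
elim: w => [|x w IHw]; first by rewrite cats0; reflexivity.
rewrite -cat1s catA hletter -catA IHw /=.
reflexivity.
Qed.

Lemma DeltaV_flip g w :
  braid_eq (inv_word Delta ++ flip g w) (flip (~~ g) w ++ inv_word Delta).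
Proof.
apply: inv_conj; rewrite Delta_flip flip_flip /= negbK.
reflexivity.
Qed.

Lemma braid_eq_inv u v : braid_eq u v -> braid_eq (inv_word u) (inv_word v).
Proof.
move=> uv; transitivity (inv_word u ++ v ++ inv_word v).
  by rewrite mul_inv_word cats0; reflexivity.
transitivity (inv_word u ++ u ++ inv_word v).
  exact: braid_cat (braid_refl _) (braid_cat (braid_sym uv) (braid_refl _)).
by rewrite catA inv_word_mul; reflexivity.
Qed.

(* [sigma_g^-1 sigma_g'^-1 = sigma_g' Delta^-1]: each junction of two negative
   syllables trades two negative letters for a positive one and [Delta^-1]. *)
Lemma negative_junction g :
  braid_eq ([:: (g, true)] ++ [:: (~~ g, true)]) (sigma (~~ g) ++ inv_word Delta).
Proof.
have DeltaV : braid_eq (inv_word Delta) [:: (~~ g, true); (g, true); (~~ g, true)].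
  by case: g => /=; [reflexivity | exact: (braid_eq_inv braid_rel)].
rewrite DeltaV; symmetry.
exact: (braid_cat (braid_cancel (~~ g) false) (braid_refl [:: (g, true); (~~ g, true)])).
Qed.

Lemma C_Delta2 : braid_eq C (Delta ++ Delta).
Proof. exact: (braid_cat (braid_refl Delta) (braid_sym braid_rel)). Qed.

Lemma inv_word_C : braid_eq (inv_word C) (inv_word Delta ++ inv_word Delta).
Proof. by rewrite -inv_word_cat; exact: braid_eq_inv C_Delta2. Qed.

(** * Normal forms of cyclic syllable words *)

Definition syllable := (gen * int)%type.

Definition word_of_syllables (ls : seq syllable) : word :=
  flatten [seq exp_word (sigma x.1) x.2 | x <- ls].

Definition admissible (x : syllable) : bool := (0 < x.2) || (x.2 <= -3).

(** Required around a cycle, this keeps the generators alternating and the positive syllables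
    isolated. *)
Definition linked (x y : syllable) : bool :=
  (x.1 != y.1) && ((x.2 < 0) || (y.2 < 0)).

Definition negative (x : syllable) : bool := x.2 < 0.

Definition both_negative (xy : syllable * syllable) : bool :=
  negative xy.1 && negative xy.2.

Definition induced (xy : syllable * syllable) : bool :=
  [&& xy.1.1, ~~ xy.2.1 & both_negative xy].

Lemma letter_pow_cancel g d n :
  (d <= n)%N -> braid_eq (nseq d (g, false) ++ nseq n (g, true)) (nseq (n - d) (g, true)).
Proof.
elim: d n => [|d IHd] [|n] //= hd; try by (rewrite ?subn0; reflexivity).
rewrite subSS -(IHd n hd).
have -> : (g, false) :: nseq d (g, false) ++ (g, true) :: nseq n (g, true) =
  nseq d (g, false) ++ [:: (g, false); (g, true)] ++ nseq n (g, true).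
  by elim: d {IHd hd} => //= d ->.
by rewrite (braid_cancel g false); reflexivity.
Qed.

Lemma flip_alternating_cons g p q pqs :
  flip g (positive_word (alternating_letters ((p, q) :: pqs))) =
  nseq p (g, true) ++ nseq q (~~ g, false) ++
    flip g (positive_word (alternating_letters pqs)).
Proof.
rewrite /alternating_letters /positive_word /flip /= !map_cat !map_nseq /=.
by rewrite addbF addbT catA.
Qed.

Lemma negative_pow d g (z : int) :
  z < 0 -> (d <= `|z|)%N ->
  braid_eq (nseq d (g, false) ++ exp_word (sigma g) z) (nseq (`|z| - d) (g, true)).
Proof. by move=> z_lt0 hd; rewrite exp_sigma z_lt0; exact: letter_pow_cancel. Qed.

Lemma nseq_split n (a : letter) : (0 < n)%N -> nseq n a = nseq n.-1 a ++ [:: a].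
Proof. by case: n => //= n _; rewrite cats1; elim: n => //= n ->. Qed.

(** An inverse letter split off [W] makes [negative_junction] applicable; the new Delta^-1 then
    moves right past [A] and flips it. *)
Lemma negative_junction_step g n W A D :
  braid_eq (sigma (~~ g) ++ W) (flip (~~ g) A ++ D) ->
  braid_eq ((nseq n (g, true) ++ [:: (g, true)]) ++ W)
    ((nseq n (g, true) ++ nseq 1 (~~ g, false) ++ flip g A) ++ inv_word Delta ++ D).
Proof.
move=> hW; rewrite -!catA.
have -> : braid_eq W ([:: (~~ g, true)] ++ sigma (~~ g) ++ W).
  symmetry; rewrite catA.
  exact: (braid_cat (braid_cancel (~~ g) true) (braid_refl W)).
rewrite hW (catA [:: (g, true)]) negative_junction -catA (catA (inv_word Delta)).
by rewrite DeltaV_flip negbK -!catA; reflexivity.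
Qed.

(* [h] plays the role of the syllable following [x :: s]; when the last syllable
   is negative it lends one letter, and [d] records whether [x] has lent one. *)
Lemma linear_normal_form (d : bool) (h x : syllable) (s : seq syllable) :
  negative x -> negative h -> path linked x (rcons s h) ->
  all admissible (x :: s) ->
  exists pqs,
    [/\ all (fun pq => (0 < pq.1) && (0 < pq.2))%N pqs,
        size pqs = count negative (x :: s) &
        braid_eq
          (nseq d (x.1, false) ++ word_of_syllables (x :: s) ++
             nseq (negative (last x s)) (h.1, true))
          (flip x.1 (positive_word (alternating_letters pqs)) ++
             flatten (nseq (count both_negative (zip (x :: s) (rcons s h)))
                        (inv_word Delta)))].
Proof.
(* Strong induction: a step consumes [x] alone or [x] with a positive syllable after it. *)
have [n] := ubnP (size s); elim: n => // n IHn in d x s *.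
move=> hn x_neg h_neg hpath /= /andP [ax hs].
(* An exponent at most -3 stays negative after losing a letter at each end. *)
have [dx dx1] : (d <= `|x.2|)%N /\ (0 < `|x.2| - d - 1)%N.
  by clear -x_neg ax; move: x_neg ax; rewrite /negative /admissible; case: d; lia.
have dx0 : (0 < `|x.2| - d)%N by exact: leq_trans dx1 (leq_subr _ _).
have negN (a b : bool) : a != b -> b = ~~ a by case: a; case: b.
rewrite /word_of_syllables /= -/(word_of_syllables s) -!catA.
case: s hn hpath hs => [|y s] hn /= /andP [/andP [/negN xy _]] hpath hs.
  (* Besides the [d] letters already lent, [x] gives one to its junction with [h], which yields one
     positive letter. *)
  exists [:: (`|x.2| - d - 1, 1)]%N.
  rewrite /both_negative /= x_neg h_neg /= flip_alternating_cons dx1.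
  split=> //; rewrite (catA (nseq d _)) negative_pow // nseq_split //.
  by rewrite xy -!catA (negative_junction x.1) subn1; reflexivity.
case/andP: hs => ay hs.
have [y_neg|y_npos] := boolP (negative y).
  have [pqs [pqs_pos pqs_size pqs_eq]] :=
    IHn true y s hn y_neg h_neg hpath (introT andP (conj ay hs)).
  exists ((`|x.2| - d - 1, 1)%N :: pqs); rewrite /both_negative /= x_neg y_neg /=.
  split; [by rewrite dx1 pqs_pos | by rewrite pqs_size /= y_neg | ].
  rewrite (catA (nseq d _)) negative_pow // nseq_split //.
  rewrite flip_alternating_cons -xy subn1.
  by rewrite xy in pqs_eq *; exact: negative_junction_step.
have y_pos : 0 < y.2.
  by clear -ay y_npos; move: ay y_npos; rewrite /admissible /negative; lia.
have yF : (y.2 < 0) = false by exact: negbTE.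
rewrite /word_of_syllables /= -/(word_of_syllables s) -!catA.
case: s hn hpath hs => [|z s] hn /= /andP [/andP [/negN yz yz_neg]] hpath hs.
  exists [:: (`|x.2| - d, `|y.2|)]%N.
  rewrite /both_negative /= x_neg /negative yF /= flip_alternating_cons.
  rewrite dx0 absz_gt0 gt_eqF //.
  split=> //; rewrite (catA (nseq d _)) negative_pow //.
  by rewrite exp_sigma -xy yF -!catA; reflexivity.
have z_neg : negative z by rewrite yF in yz_neg.
(* The positive syllable [y] supplies the positive exponent itself, so [z] has lent no letter. *)
have [pqs [pqs_pos pqs_size pqs_eq]] := IHn false z s (ltnW hn) z_neg h_neg hpath hs.
exists ((`|x.2| - d, `|y.2|)%N :: pqs).
rewrite /both_negative /= x_neg /negative yF /=.
split; [by rewrite dx0 absz_gt0 gt_eqF | by rewrite /= pqs_size | ].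
rewrite (catA (nseq d _)) negative_pow // flip_alternating_cons -xy.
rewrite exp_sigma yF -[X in braid_eq _ X]catA -[X in braid_eq _ (_ ++ X)]catA.
rewrite yz xy negbK in pqs_eq.
exact: (braid_cat (braid_refl _) (braid_cat (braid_refl _) pqs_eq)).
Qed.

(** From one negative syllable to the next, the generator changes at a direct junction and is
    restored across a positive syllable. Hence junctions sigma_2 sigma_1 and sigma_1 sigma_2
    alternate, and the latter exceed the former by [h.1 - x.1]. *)
Lemma junction_parity (h x : syllable) (s : seq syllable) :
  negative x -> negative h -> path linked x (rcons s h) ->
  (count both_negative (zip (x :: s) (rcons s h)) + x.1 =
   (count induced (zip (x :: s) (rcons s h))).*2 + h.1)%N.
Proof.
have [n] := ubnP (size s); elim: n => // n IHn in x s *.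
move=> hn x_neg h_neg.
case: s hn => [|y s] hn.
  rewrite /= /induced /both_negative /= x_neg h_neg !andbT !addn0 => /andP [].
  by case: (x.1) (h.1) => [] [].
move=> /andP []; have [y_neg|y_npos] := boolP (negative y).
  move=> /andP [xy _] /(IHn y s hn y_neg h_neg) /=.
  rewrite /induced /both_negative /= x_neg y_neg !andbT doubleD.
  by move: xy; case: (x.1) (y.1) => [] [] //= _; lia.
case: s hn => [|z s] hn /andP [xy _] /= /andP [/andP [yz yz_neg]].
  rewrite /= /induced /both_negative /= (negbTE y_npos) !(andbF, andbT) /= => _.
  by move: xy yz; case: (x.1) (y.1) (h.1) => [] [] [].
have z_neg : negative z.
  by move: yz_neg y_npos; rewrite /negative => /orP [->|].
move/(IHn z s (ltnW hn) z_neg h_neg) => /= IH.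
rewrite /induced /both_negative /= (negbTE y_npos) !(andbF, andbT) /= !add0n.
by move: xy yz IH; rewrite /induced /both_negative; case: (x.1) (y.1) (z.1) => [] [] [].
Qed.

Lemma exp_wordN w n : exp_word w (- n%:Z) = flatten (nseq n (inv_word w)).
Proof. by rewrite /exp_word; case: n => // n; rewrite oppr_lt0 abszN. Qed.

Lemma DeltaV_double n :
  braid_eq (flatten (nseq n.*2 (inv_word Delta))) (exp_word C (- n%:Z)).
Proof.
rewrite exp_wordN; elim: n => [|n IHn]; first reflexivity.
rewrite doubleS -[LHS in braid_eq LHS]/(_ ++ _ ++ flatten _) catA.
exact: braid_cat (braid_sym inv_word_C) IHn.
Qed.

Lemma C_central n w :
  braid_eq (exp_word C (- n%:Z) ++ w) (w ++ exp_word C (- n%:Z)).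
Proof.
have CVw : braid_eq (inv_word C ++ w) (w ++ inv_word C).
  have DVw := DeltaV_flip true w; have := DeltaV_flip false w.
  rewrite flip_false => DVw'.
  by rewrite inv_word_C -catA DVw' catA DVw flip_false -catA; reflexivity.
rewrite exp_wordN; elim: n => [|n]; first by rewrite cats0; reflexivity.
rewrite -[flatten (nseq n.+1 _)]/(inv_word C ++ flatten (nseq n (inv_word C))).
move: (flatten _) => F IHn.
by rewrite -catA IHn catA CVw -catA; reflexivity.
Qed.

(** Conjugating by [inv_word Delta] turns [flip true u] back into [u] and keeps [v], which commutes
    with [Delta]. *)
Lemma flip_conj g u v :
  braid_eq (Delta ++ v) (v ++ Delta) -> braid_conj (flip g u ++ v) (u ++ v).
Proof.
case: g => vD; last by rewrite flip_false; exact/braid_eq_conj/braid_refl.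
exists (inv_word Delta); rewrite catA catA DeltaV_flip flip_false inv_wordK.
by rewrite -!catA -vD (catA (inv_word Delta)) inv_word_mul; reflexivity.
Qed.

Definition cyclic_pairs (ls : seq syllable) := zip ls (rot 1 ls).

(** The linear form is closed up with [h = x]: the first syllable lends a letter exactly when the
    last one is negative. *)
Lemma normal_form_negative_head x s :
  negative x -> cycle linked (x :: s) -> all admissible (x :: s) ->
  exists pqs,
    [/\ size pqs = count negative (x :: s) &
        schreier_normal_form (word_of_syllables (x :: s))
          (- (count induced (cyclic_pairs (x :: s)))%:Z) (Alternating pqs)].
Proof.
move=> x_neg hc ha; rewrite /cyclic_pairs rot1_cons.
have [pqs [pqs_pos pqs_size pqs_eq]] :=
  linear_normal_form (negative (last x s)) x_neg x_neg hc ha.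
exists pqs; split=> //; split.
  by rewrite /= pqs_pos pqs_size /= x_neg.
(* The end bits agree and cancel, so the number of Delta^-1 is even and they pair up to powers of
   C^-1. *)
have := junction_parity x_neg x_neg hc; move/addIn => hm.
rewrite hm in pqs_eq.
set n := count induced _ in pqs_eq *.
set v := positive_word _ in pqs_eq.
have conj1 : braid_conj (word_of_syllables (x :: s)) (flip x.1 v ++ exp_word C (- n%:Z)).
  (* Conjugating by the lent letter carries it from the front to the back. *)
  exists (nseq (negative (last x s)) (x.1, false)).
  rewrite -DeltaV_double -pqs_eq.
  by case: (negative (last x s)); reflexivity.
apply: braid_conj_trans conj1 _.
rewrite tail_word_alternating.
apply: (braid_conj_trans (v := v ++ exp_word C (- n%:Z))).
  apply: flip_conj; symmetry; exact: C_central.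
exact/braid_eq_conj/braid_sym/C_central.
Qed.

(** After a positive first syllable comes a negative one, and rotation by one syllable is a
    conjugation preserving both counts. *)
Lemma normal_form_of_cycle ls :
  ls != [::] -> cycle linked ls -> all admissible ls ->
  exists pqs,
    [/\ size pqs = count negative ls &
        schreier_normal_form (word_of_syllables ls)
          (- (count induced (cyclic_pairs ls))%:Z) (Alternating pqs)].
Proof.
case: ls => // x s _ hc ha.
have [x_neg|x_pos] := boolP (negative x); first exact: normal_form_negative_head.
case: s hc ha => [|y s] hc ha; first by move: hc; rewrite /= /linked eqxx.
have y_neg : negative y.
  by move: hc x_pos; rewrite /= /linked /negative => /andP [/andP [_ /orP [->|]]].
have hrot : rot 1 [:: x, y & s] = y :: rcons s x by rewrite rot1_cons.
have hc' : cycle linked (y :: rcons s x) by rewrite -hrot rot_cycle.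
have ha' : all admissible (y :: rcons s x) by rewrite -hrot (eq_all_r (mem_rot 1 _)).
have [pqs [pqs_size [pqs_pos pqs_conj]]] := normal_form_negative_head y_neg hc' ha'.
exists pqs; split; first by rewrite pqs_size -hrot; apply/permP; rewrite perm_rot.
split=> //.
apply: (braid_conj_trans (v := word_of_syllables (y :: rcons s x))).
  rewrite -rcons_cons -cats1 /word_of_syllables map_cat flatten_cat /= cats0.
  exact: braid_conj_catC.
suff -> : count induced (cyclic_pairs [:: x, y & s]) =
          count induced (cyclic_pairs (y :: rcons s x)) by [].
rewrite /cyclic_pairs !rot1_cons -rcons_cons zip_rcons; last by rewrite !size_rcons.
by rewrite -[rcons (zip _ _) _]cats1 count_cat /= addn0 addnC.
Qed.

(** * Negative twist regions *)

Lemma path_zip (T : Type) (e : rel T) x s h :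
  path e x (rcons s h) = all (fun p => e p.1 p.2) (zip (x :: s) (rcons s h)).
Proof. by elim: s x => [|y s IHs] x //=; rewrite IHs. Qed.

(** * Syllables as blocks of letters *)

Section Blocks.
Local Open Scope nat_scope.
Variable sh : seq nat.
Hypothesis sh_pos : all (leq 1) sh.

Lemma reshape_index_mono c c' :
  c <= c' -> reshape_index sh c <= reshape_index sh c'.
Proof. by rewrite (reshape_leq sh) => /orP [/ltnW | /andP [/eqP ->]]. Qed.

(** As no block is empty, the last letter of a block is followed by the first letter of the next
    block, cyclically. *)
Lemma reshape_index_succ c (N := sumn sh) :
  c < N ->
  reshape_index sh (c.+1 %% N) = reshape_index sh c \/
  reshape_index sh (c.+1 %% N) = (reshape_index sh c).+1 %% size sh.
Proof.
move=> cN; set r := reshape_index sh c; set o := reshape_offset sh c.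
have rlt : r < size sh by exact: reshape_indexP.
have cE : flatten_index sh r o = c by exact: reshape_indexK.
have olt : o < nth 0 sh r by exact: reshape_offsetP.
have sh0 k : k < size sh -> 0 < nth 0 sh k by move=> hk; apply: (all_nthP 0 sh_pos).
have [o1|o1] := ltnP o.+1 (nth 0 sh r).
  left; have c1E : c.+1 = flatten_index sh r o.+1 by rewrite -cE /flatten_index addnS.
  by rewrite modn_small c1E ?flatten_indexKl ?flatten_indexP.
have {o1} oE : o.+1 = nth 0 sh r by apply/eqP; rewrite eqn_leq olt o1.
have c1E : c.+1 = flatten_index sh r.+1 0.
  by rewrite /flatten_index (take_nth 0) // sumn_rcons -oE addn0 addnS -cE.
right; have [r1|r1] := ltnP r.+1 (size sh).
  by rewrite !modn_small ?c1E ?flatten_indexKl ?flatten_indexP // sh0.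
have rE : r.+1 = size sh by apply/eqP; rewrite eqn_leq rlt r1.
have -> : c.+1 = N by rewrite c1E rE /flatten_index take_size addn0.
rewrite modnn rE modnn.
have h0 : 0 < nth 0 sh 0 by apply: sh0; apply: leq_trans rlt.
by have := flatten_indexKl h0; rewrite /flatten_index take0.
Qed.

End Blocks.

Section NegativeTwistRegions.
Variable ls : seq syllable.
Hypothesis ls_linked : cycle linked ls.
Hypothesis ls_admissible : all admissible ls.

Let w := word_of_syllables ls.
Let x0 : syllable := (false, 0).
Let sh := shape [seq exp_word (sigma x.1) x.2 | x <- ls].
Let block (c : nat) : nat := reshape_index sh c.

Lemma size_sh : size sh = size ls.
Proof. by rewrite /sh /shape !size_map. Qed.

Lemma nth_sh k : (k < size ls)%N -> nth 0%N sh k = `|(nth x0 ls k).2|%N.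
Proof.
move=> hk; rewrite /sh /shape -map_comp (nth_map x0) //=.
by rewrite exp_sigma size_nseq.
Qed.

Lemma sh_pos : all (leq 1) sh.
Proof.
apply/(all_nthP 0%N) => k; rewrite size_sh => hk; rewrite nth_sh //.
by have := all_nthP x0 ls_admissible k hk; rewrite /admissible; lia.
Qed.

Lemma block_lt (c : crossing w) : (block c < size ls)%N.
Proof. by rewrite -size_sh; apply: reshape_indexP; rewrite -size_flatten. Qed.

Lemma crossing_letterE (c : crossing w) :
  crossing_letter c = ((nth x0 ls (block c)).1, (nth x0 ls (block c)).2 < 0).
Proof.
rewrite /crossing_letter (tnth_nth (false, false)) /= nth_flatten -/sh -/(block c).
rewrite (nth_map x0) ?block_lt // exp_sigma nth_nseq ifT //.
rewrite -nth_sh ?block_lt //.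
by apply: reshape_offsetP; rewrite -size_flatten.
Qed.

Lemma block_succ (c : crossing w) :
  block (ordS c) = block c \/ block (ordS c) = ((block c).+1 %% size ls)%N.
Proof.
have := @reshape_index_succ sh sh_pos c; rewrite -size_flatten size_sh.
by apply; exact: ltn_ord.
Qed.

Lemma linked_succ k :
  (k < size ls)%N -> linked (nth x0 ls k) (nth x0 ls (k.+1 %% size ls)).
Proof.
case: ls ls_linked => // x s /(pathP x0) hp hk.
have := hp k; rewrite size_rcons => /(_ hk).
have -> : nth x0 (x :: rcons s x) k = nth x0 (x :: s) k.
  by rewrite -rcons_cons nth_rcons /= hk.
rewrite nth_rcons; move: hk; rewrite /= ltnS leq_eqVlt => /orP [/eqP ->|hk].
  by rewrite ltnn eqxx modnn.
by rewrite hk modn_small.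
Qed.

(** Cyclically consecutive syllables have different generators, so a repeated generator means that
    no syllable boundary is crossed. *)
Lemma block_adjacent (c : crossing w) :
  (crossing_letter c).1 = (crossing_letter (ordS c)).1 -> block (ordS c) = block c.
Proof.
rewrite !crossing_letterE /=; case: (block_succ c) => // ->.
by have /andP [/eqP] := linked_succ (block_lt c).
Qed.

Definition in_block (k : nat) : {set crossing w} := [set c : crossing w | block c == k].

Lemma block_start k o :
  (k < size ls)%N -> (o < `|(nth x0 ls k).2|)%N ->
  exists c : crossing w, block c = k /\ val c = flatten_index sh k o.
Proof.
move=> hk; rewrite -nth_sh // => ho.
have hc : (flatten_index sh k o < size w)%N.
  by rewrite size_flatten; exact: flatten_indexP.
by exists (Ordinal hc); split=> //; exact: flatten_indexKl.
Qed.

Lemma negative_block_size (c : crossing w) :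
  (crossing_letter c).2 -> (3 <= `|(nth x0 ls (block c)).2|)%N.
Proof.
rewrite crossing_letterE /=.
by have := all_nthP x0 ls_admissible _ (block_lt c); rewrite /admissible; lia.
Qed.

Lemma size_w_gt1 (c : crossing w) : (crossing_letter c).2 -> (1 < size w)%N.
Proof.
move=> /negative_block_size h3.
have [c1 [_ e1]] := block_start (block_lt c) (ltnW h3).
have := ltn_ord c1; rewrite [nat_of_ord c1]e1 /flatten_index; lia.
Qed.

(** In the unbounded case only [c] and [c'] carry the generator; since the negative syllable of [c]
    has further crossings, [c'] must be one of them. *)
Lemma bigon_between_block (c c' : crossing w) :
  (crossing_letter c).2 -> bigon_between c c' -> block c' = block c.
Proof.
move=> c_neg /(bigon_between_inv (size_w_gt1 c_neg)) [gg' [c'E|[cE|hall]]].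
- by rewrite c'E in gg' *; exact: block_adjacent.
- by rewrite cE in gg' *; rewrite block_adjacent.
have h3 := negative_block_size c_neg.
have hk := block_lt c.
have [c0 [b0 e0]] := block_start hk (ltnW (ltnW h3)).
have [c1 [b1 e1]] := block_start hk (ltnW h3).
have hg (x : crossing w) : block x = block c -> x = c \/ x = c'.
  by move=> bx; apply: hall; rewrite !crossing_letterE bx.
have [<- //|nb] := eqVneq (block c') (block c).
have hc (x : crossing w) : block x = block c -> x = c.
  by move=> bx; case: (hg x bx) => // xc; rewrite -xc bx eqxx in nb.
move: e0 e1; rewrite (hc _ b0) (hc _ b1) /flatten_index => ->; lia.
Qed.

(** Bigons never leave a negative syllable; conversely, all letters between two letters of one
    syllable belong to it, and consecutive ones span bigons. *)
Lemma connect_block (c c' : crossing w) :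
  (crossing_letter c).2 ->
  connect (@bigon_between w) c c' = (block c' == block c).
Proof.
move=> c_neg; have w1 := size_w_gt1 c_neg; apply/idP/eqP.
  case/connectP => p; elim: p c c_neg => [|y p IHp] c c_neg /=; first by move=> _ ->.
  move=> /andP [cy hp] c'E; have by_ := bigon_between_block c_neg cy.
  rewrite -by_; apply: IHp => //.
  by rewrite crossing_letterE by_ -crossing_letterE.
have main (a b : crossing w) : (a <= b)%N -> block a = block b ->
    connect (@bigon_between w) a b /\ connect (@bigon_between w) b a.
  move: {2}(b - a)%N (leqnn (b - a)) => n.
  elim: n a => [|n IHn] a hn ab bab.
    have -> : a = b by apply: ord_inj; lia.
    by rewrite connect0.
  have [-> | a_neq_b] := eqVneq a b; first by rewrite connect0.
  have a_lt_b : (a < b)%N by rewrite ltn_neqAle ab andbT; exact: a_neq_b.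
  have aS : ordS a = a.+1 :> nat.
    by rewrite /= modn_small // (leq_ltn_trans a_lt_b).
  have baS : block (ordS a) = block b.
    apply/eqP; rewrite eqn_leq aS reshape_index_mono //= -bab.
    by rewrite reshape_index_mono.
  have gg : (crossing_letter a).1 = (crossing_letter (ordS a)).1.
    by rewrite !crossing_letterE baS bab.
  have [h1 h2] := bigon_between_step w1 (erefl (ordS a)) gg.
  have [| |h3 h4] := IHn (ordS a) _ _ baS; [by rewrite aS; lia | by rewrite aS | ].
  split; first exact: connect_trans (connect1 h1) h3.
  exact: connect_trans h4 (connect1 h2).
move=> bb; case: (leqP c c') => hcc; first by have [] := main c c' hcc (esym bb).
by have [] := main c' c (ltnW hcc) bb.
Qed.

Lemma negative_twist_regionsE :
  negative_twist_regions w =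
  [set in_block (val k)
    | k : 'I_(size ls) in [set k : 'I_(size ls) | negative (nth x0 ls k)]].
Proof.
apply/setP => S; apply/idP/imsetP.
  rewrite inE => /andP [/imsetP [c _ SE] /forall_inP S_neg].
  have c_neg : (crossing_letter c).2 by apply: S_neg; rewrite SE inE connect0.
  exists (Ordinal (block_lt c)).
    by rewrite inE /= /negative; rewrite crossing_letterE in c_neg.
  by rewrite SE; apply/setP => c'; rewrite !inE connect_block.
case=> k; rewrite inE => k_neg ->.
have k_pos : (0 < `|(nth x0 ls k).2|)%N by move: k_neg; rewrite /negative; lia.
have [c [ck _]] := block_start (ltn_ord k) k_pos.
have c_neg : (crossing_letter c).2 by rewrite crossing_letterE ck.
rewrite inE; apply/andP; split.
  apply/imsetP; exists c => //.
  by apply/setP => c'; rewrite !inE connect_block // ck.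
by apply/forall_inP => c'; rewrite inE => /eqP c'k; rewrite crossing_letterE c'k.
Qed.

Lemma t_minus_word_of_syllables : t_minus w = count negative ls.
Proof.
rewrite /t_minus negative_twist_regionsE card_in_imset.
  rewrite -sum1_count (big_nth x0) big_mkord -sum1_card.
  by apply: eq_bigl => k; rewrite inE.
move=> k k'; rewrite !inE => k_neg _ /setP kk'; apply: val_inj.
have k_pos : (0 < `|(nth x0 ls k).2|)%N by move: k_neg; rewrite /negative; lia.
have [c [ck _]] := block_start (ltn_ord k) k_pos.
by have := kk' c; rewrite !inE ck eqxx => /esym/eqP.
Qed.

End NegativeTwistRegions.

(** * From exponent tuples to cyclic lists of syllables *)

Lemma cycle_zip (T : Type) (e : rel T) s :
  cycle e s = all (fun p => e p.1 p.2) (zip s (rot 1 s)).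
Proof. by case: s => // x s; rewrite rot1_cons -path_zip. Qed.

(** This matches the successor [ordS] on indices with the rotation of lists. *)
Lemma rot1_enum_ord n : rot 1 (enum 'I_n) = map (@ordS n) (enum 'I_n).
Proof.
apply: (inj_map val_inj); rewrite map_rot val_enum_ord -map_comp.
case: n => [|n]; first by rewrite enum_ord0.
apply: (@eq_from_nth _ 0%N).
  by rewrite size_rot size_map size_iota size_enum_ord.
move=> k; rewrite size_rot size_iota => hk.
rewrite (nth_map ord0) ?size_enum_ord //= nth_enum_ord // rot1_cons nth_rcons size_iota.
have [kn|nk] := ltnP k n; first by rewrite nth_iota // modn_small.
have -> : k = n by lia.
by rewrite eqxx modnn.
Qed.

Lemma card_set_count n (P : pred 'I_n) : #|[set q | P q]| = count P (enum 'I_n).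
Proof.
rewrite -sum1_count -sum1_card big_enum_cond.
by apply: eq_bigl => q; rewrite inE.
Qed.

Section SyllableList.
Variables (i j : gen) (l : nat) (r : l.*2.-tuple int).

Definition syllables : seq syllable :=
  [seq (syl_gen i j q, tnth r q) | q <- enum 'I_(l.*2)].

Lemma syllable_wordE : syllable_word i j r = word_of_syllables syllables.
Proof. by rewrite /word_of_syllables -map_comp. Qed.

Lemma cyclic_pairs_syllables :
  cyclic_pairs syllables =
  [seq ((syl_gen i j q, tnth r q), (syl_gen i j (ordS q), tnth r (ordS q)))
     | q <- enum 'I_(l.*2)].
Proof. by rewrite /cyclic_pairs -map_rot rot1_enum_ord -map_comp zip_map. Qed.

Lemma count_negative_syllables :
  count negative syllables = #|negative_syllables r|.
Proof. by rewrite card_set_count count_map. Qed.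

Lemma count_induced_syllables :
  (forall q, tnth r q < 0 -> tnth r q <= -3) ->
  count induced (cyclic_pairs syllables) = #|induced_products i j r|.
Proof.
move=> hneg; rewrite card_set_count cyclic_pairs_syllables count_map.
have neg3 q : (tnth r q < 0) = (tnth r q <= -3).
  by apply/idP/idP => [/hneg // | h]; apply: le_lt_trans h _.
apply: eq_count => q /=.
by rewrite /induced /both_negative /negative /= !neg3 eqb_id eqbF_neg.
Qed.

Lemma syllables_linked :
  i != j -> (forall q, tnth r q != 0) ->
  (forall q, 0 < tnth r q -> tnth r (ord_pred q) < 0 /\ tnth r (ordS q) < 0) ->
  cycle linked syllables.
Proof.
move=> hij hr hpos; rewrite cycle_zip -/(cyclic_pairs _) cyclic_pairs_syllables.
rewrite all_map; apply/allP => q _; rewrite /linked /=; apply/andP; split.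
  (* The number of syllables is even, so parity alternates across the wraparound too. *)
  rewrite /syl_gen /= odd_mod ?odd_double //=.
  by case: (odd q); rewrite //= eq_sym.
by case: (ltgtP (tnth r q) 0) (hr q) (hpos q) => //= _ _ [].
Qed.

Lemma syllables_admissible :
  (forall q, tnth r q != 0) -> (forall q, tnth r q < 0 -> tnth r q <= -3) ->
  all admissible syllables.
Proof.
move=> hr hneg; rewrite all_map; apply/allP => q _.
rewrite /admissible /=.
by case: (ltgtP (tnth r q) 0) (hr q) (hneg q) => //= _ _ ->.
Qed.

End SyllableList.

Theorem theorem3p1 (i j : gen) (l : nat) (r : (l.*2).-tuple int)
    (hij : i != j) (hl : (2 <= l)%N)
    (hr : forall q, tnth r q != 0)
    (hneg : forall q, tnth r q < 0 -> tnth r q <= -3)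
    (hpos : forall q, 0 < tnth r q ->
       tnth r (ord_pred q) < 0 /\ tnth r (ordS q) < 0) :
  let beta := syllable_word i j r in
  generic beta /\
  forall (k : int) (pqs : seq (nat * nat)),
    schreier_normal_form beta k (Alternating pqs) ->
    [/\ k = - (#|induced_products i j r|%:Z),
        size pqs = t_minus beta &
        t_minus beta = #|negative_syllables r| ].
Proof.
move=> beta.
have linked_ls := syllables_linked hij hr hpos.
have admissible_ls := syllables_admissible i j hr hneg.
have ls_neq0 : syllables i j r != [::].
  by rewrite -size_eq0 size_map size_enum_ord; lia.
have [pqs0 [size0]] := normal_form_of_cycle ls_neq0 linked_ls admissible_ls.
rewrite count_induced_syllables // -syllable_wordE => nf0.
have tE : t_minus beta = #|negative_syllables r|.
  by rewrite /beta syllable_wordE t_minus_word_of_syllables // count_negative_syllables.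
split; first by eexists; exists pqs0; exact: nf0.
(* Conjugacy invariance transfers the values from the constructed form to any other. *)
move=> k pqs nf; have [-> ->] := alternating_normal_form_inj nf nf0.
by rewrite size0 tE count_negative_syllables.
Qed.
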